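(* Let $N\ge 1$, $\alpha_1,\dots,\alpha_N\in\{0,1\}$, $R(z)=\exp(r(z))\in \mathrm{Id}+z\,\mathrm{End}(\mathbb C^N)[[z]]$, $T(z)=\sum_{j\ge1}\sum_a\Delta T^a_j z^j\tilde e_a\in z\mathbb C^N[[z]]$ with $\Delta T_1^a=0$ whenever $\alpha_a=1$, and $\Delta=(\Delta_1,\dots,\Delta_N)\in(\mathbb C\setminus\{0\})^N$ (with fixed square roots $\sqrt{\Delta_a}$). Let $Z=\widehat R\,\widehat T\,\widehat\Delta\cdot\prod_{a=1}^N\tau_{\alpha_a}(\hbar,\mathbf T^a)$ be the associated generalized ancestor potential and let $\widehat L^a_m$ ($1\le a\le N$, $m\ge-\alpha_a$) be the associated Virasoro operators (all defined in the context). Then $$\widehat L^a_m\cdot Z=0\qquad\text{for all }a=1,\dots,N,\ m\ge-\alpha_a .$$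
   Context: Notation. $(2k-1)!!=1\cdot3\cdots(2k-1)$, $(-1)!!=1$. $\mathbb C^N$ has orthonormal basis $\tilde e_1,\dots,\tilde e_N$. Formal variables $\mathbf T=\{T^a_k\}_{1\le a\le N,\,k\ge0}$, $\mathbf T^a=\{T^a_k\}_{k\ge0}$; $T_k^a$ and $\partial/\partial T_k^a$ are $0$ for $k<0$. Operators are (formal completions of) differential operators acting on $\mathbb C[\mathbf T][[\hbar]]$ (with a possible factor $\hbar^{-1}$). Virasoro operators in one family $\{T_k\}_{k\ge 0}$: $$\widehat L_m=\tfrac12\sum_{i+j=-m-1}\frac{T_iT_j}{(2i-1)!!(2j-1)!!}+\sum_{k\ge0}\frac{(2k+2m+1)!!}{(2k-1)!!}T_k\frac{\partial}{\partial T_{k+m}}+\tfrac12\sum_{i+j=m-1}(2i+1)!!(2j+1)!!\frac{\partial^2}{\partial T_i\partial T_j};$$ $\widehat L_m(\mathbf T^a)$ is this operator in the variables $\mathbf T^a$. Tau-functions. $\tau_1$ is the Kontsevich--Witten tau-function $\tau_1(\hbar,\mathbf T)=\exp\big(\sum_{2g-2+n>0}\frac{\hbar^{2g-2+n}}{n!}\sum_{k_1,\dots,k_n\ge0}\int_{\overline{\mathcal M}_{g,n}}\psi_1^{k_1}\cdots\psi_n^{k_n}\,T_{k_1}\cdots T_{k_n}\big)$; $\tau_0$ is the Brézin--Gross--Witten tau-function, given by the same formula with Norbury's class $\Theta_{g,n}\in H^{4g-4+2n}(\overline{\mathcal M}_{g,n})$ inserted in the integral. Equivalently (known), $\tau_\alpha$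 is the unique element of $\mathbb C[\mathbf T][[\hbar]]$ with $\tau_\alpha|_{\mathbf T=0}=1$ and $\big(\tfrac12\widehat L_k-\frac{(2k+2\alpha+1)!!}{2\hbar}\frac{\partial}{\partial T_{k+\alpha}}+\frac{\delta_{k,0}}{16}\big)\tau_\alpha=0$ for all $k\ge-\alpha$. Operators. Write $r(z)=\sum_{k\ge1}r_kz^k$, $r_k\tilde e_a=\sum_b(r_k)^b_a\tilde e_b$, $(r_k)^{ab}=(r_k)_a^b$. Then $$\widehat R=\exp\Big(\sum_{k\ge1}\sum_{a,b}\Big(\sum_{j\ge0}(r_k)^b_aT^a_j\frac{\partial}{\partial T^b_{k+j}}+\tfrac12\sum_{j=0}^{k-1}(-1)^{j+1}(r_k)^{ab}\frac{\partial^2}{\partial T^a_j\partial T^b_{k-j-1}}\Big)\Big),$$ $$\widehat T=\exp\Big(\frac1\hbar\sum_{k\ge1}\sum_a\Delta T^a_k\frac{\partial}{\partial T^a_k}\Big),\qquad \widehat\Delta\cdot\prod_a\tau_{\alpha_a}(\hbar,\mathbf T^a)=\prod_a\tau_{\alpha_a}(\hbar\sqrt{\Delta_a},\mathbf T^a).$$ No symplectic condition on $R$ is assumed. Associated Virasoro operators. For $1\le a\le N$, $m\ge-\alpha_a$, the operator $\widehat L^a_m$ is the conjugate by $\widehat R\widehat T\widehat\Delta$ of $\tfrac12\widehat L_m(\mathbf T^a)-\frac{(2m+2\alpha_a+1)!!}{2\hbar}\frac{\partial}{\partial T^a_{m+\alpha_a}}+\frac{\delta_{m,0}}{16}$, where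 conjugation by $\widehat\Delta$ replaces $\hbar$ by $\hbar\sqrt{\Delta_a}$ in the $a$-th factor. Explicitly, $\widehat L^a_m=\widehat R\,\widehat\Lambda^a_m\,\widehat R^{-1}$ with $$\widehat\Lambda^a_m=\tfrac12\widehat L_m(\mathbf T^a)-\frac{(2m+2\alpha_a+1)!!}{2\hbar\sqrt{\Delta_a}}\frac{\partial}{\partial T^a_{m+\alpha_a}}+\frac1{2\hbar}\sum_{k\ge1+\alpha_a}\frac{(2m+2k+1)!!}{(2k-1)!!}\Delta T^a_k\frac{\partial}{\partial T^a_{m+k}}+\frac{\delta_{m,0}}{16}.$$ *)

(* Defs.v *)
From HB Require Import structures.
From mathcomp Require Import all_boot all_order all_algebra finmap.
From mathcomp Require Import boolp classical_sets cardinality fsbigop reals.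
From mathcomp Require Import complex.
From mathcomp Require Import monalg.

Set Implicit Arguments.
Unset Strict Implicit.
Unset Printing Implicit Defensive.

Import Order.TTheory GRing.Theory Num.Theory.

Local Open Scope classical_set_scope.
Local Open Scope ring_scope.

(* Every infinite sum below is a finite-support sum ([fsbigop]): it has the
   intended value when all but finitely many terms vanish, and is 0 otherwise.
   The operators given by infinite sums (and the exponential Rhat) are locally
   finite on polynomials, so the first case always applies to them.  The one
   exception is That, which is defined only on part of the space; its domain is
   [That_defined]. *)

(* (2 k - 1)!!, with (-1)!! = 1; for k < 0 the value is immaterial. *)
Definition oddfact (k : int) : nat :=
  if k is Posz n then (\prod_(j < n) (2 * j + 1))%N else 1%N.

Section Polynomials.
Variables (K : fieldType) (I : choiceType).

(* C[T] for a family of variables indexed by the possibly infinite type I. *)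
Definition tpoly := {malg K[{cmonom I}]}.

Definition tvar (i : I) : tpoly := << ucm i >>.

Definition tderiv (i : I) (p : tpoly) : tpoly :=
  \sum_(m <- msupp p) << p@_m *+ m i *g divcm m (ucm i) >>.

(* F n is the coefficient of hbar ^ n.  No lower bound on the exponents is
   imposed, since That involves all negative powers of hbar. *)
Definition hseries := int -> tpoly.

Definition coefwise (A : tpoly -> tpoly) (F : hseries) : hseries :=
  fun n => A (F n).

Definition hinv (F : hseries) : hseries := fun n => F (n + 1).

Definition opp_op (A : hseries -> hseries) (F : hseries) : hseries :=
  fun n => - A F n.

Definition op_exp (A : hseries -> hseries) (F : hseries) : hseries :=
  fun n => \sum_(l \in [set: nat]) (l`!%:R)^-1 *: iter l A F n.

Definition op_exp_defined (A : hseries -> hseries) (F : hseries) : Prop :=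
  forall n, finite_set [set l : nat | iter l A F n != 0].

(* Power series in hbar, i.e. C[T][[hbar]], and their Cauchy product. *)
Definition pseries := nat -> tpoly.

Definition pone : pseries := fun n => (n == 0%N)%:R.

Definition pmul (f g : pseries) : pseries :=
  fun n => \sum_(i < n.+1) f i * g (n - i)%N.

Definition to_hseries (f : pseries) : hseries :=
  fun n => if n is Posz k then f k else 0.

Section Virasoro.

(* v selects the family T_k = tvar (v k) in which the operator acts. *)
Variable v : nat -> I.

Definition fderiv (k : int) (p : tpoly) : tpoly :=
  if k is Posz n then tderiv (v n) p else 0.

(* The indices of the two finite sums are at most |m|. *)
Definition virasoro (m : int) (p : tpoly) : tpoly :=
  2^-1 *: (\sum_(i < `|m|.+1) \sum_(j < `|m|.+1 | i%:Z + j%:Z == - m - 1)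
             ((oddfact i)%:R * (oddfact j)%:R)^-1 *:
               (tvar (v i) * (tvar (v j) * p)))
  + \sum_(k \in [set: nat])
      ((oddfact (k%:Z + m + 1))%:R / (oddfact k)%:R) *:
        (tvar (v k) * fderiv (k%:Z + m) p)
  + 2^-1 *: (\sum_(i < `|m|.+1) \sum_(j < `|m|.+1 | i%:Z + j%:Z == m - 1)
               ((oddfact (i%:Z + 1))%:R * (oddfact (j%:Z + 1))%:R) *:
                 tderiv (v i) (tderiv (v j) p)).

(* The operator annihilating tau_al (s * hbar, T). *)
Definition tau_virasoro (al : nat) (s : K) (m : int) (F : hseries) : hseries :=
  fun n =>
    2^-1 *: virasoro m (F n)
    - ((oddfact (m + al%:Z + 1))%:R / (2 * s)) *:
        fderiv (m + al%:Z) (hinv F n)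
    + ((m == 0)%:R / 16) *: F n.

End Virasoro.
End Polynomials.

Arguments tvar {K I} i.

(* Characterization of the Brezin-Gross-Witten (al = 0) and Kontsevich-Witten
   (al = 1) tau-functions by their Virasoro constraints and their value at
   T = 0, which is the coefficient of the monomial 1. *)
Definition is_tau (K : fieldType) (al : nat) (tau : pseries K nat) : Prop :=
  (forall n, (tau n)@_(onecm nat) = (n == 0%N)%:R) /\
  (forall k : int, - al%:Z <= k ->
   forall n : int, tau_virasoro id al 1 k (to_hseries tau) n = 0).

(* The substitution of T_(v k) for T_k. *)
Definition rename (K : fieldType) (I J : choiceType) (v : I -> J)
    (p : tpoly K I) : tpoly K J :=
  mmap (fun c : K => malgC c)
    (fun m : {cmonom I} =>
       \prod_(k <- finsupp (cmonom_val m)) tvar (v k) ^+ m k) p.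

Section Ancestor.
Variables (K : fieldType) (N : nat).

Notation idx := ('I_N * nat)%type.
Notation poly := (tpoly K idx).
Notation ser := (hseries K idx).

(* r k is the matrix of r_k acting on column vectors: r_k e_a is the sum over b
   of r k b a times e_b, so (r_k)^b_a = (r_k)^{ab} = r k b a.  The matrix r 0
   is never used. *)
Definition Rlog (r : nat -> 'M[K]_N) (p : poly) : poly :=
  \sum_(k \in [set k : nat | (1 <= k)%N]) \sum_(a < N) \sum_(b < N)
    (\sum_(j \in [set: nat])
        r k b a *: (tvar (a, j) * tderiv (b, (k + j)%N) p)
     + 2^-1 *: \sum_(j < k)
        ((-1) ^+ j.+1 * r k b a) *:
          tderiv (a, j : nat) (tderiv (b, (k - j - 1)%N) p)).

Definition Rhat (r : nat -> 'M[K]_N) : ser -> ser :=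
  op_exp (coefwise (Rlog r)).

Definition Rhat_inv (r : nat -> 'M[K]_N) : ser -> ser :=
  op_exp (opp_op (coefwise (Rlog r))).

(* dT a 0 is never used. *)
Definition Tlog (dT : 'I_N -> nat -> K) (p : poly) : poly :=
  \sum_(k \in [set k : nat | (1 <= k)%N]) \sum_(a < N)
    dT a k *: tderiv (a, k) p.

Definition That (dT : 'I_N -> nat -> K) : ser -> ser :=
  op_exp (fun F => hinv (coefwise (Tlog dT) F)).

Definition That_defined (dT : 'I_N -> nat -> K) (F : ser) : Prop :=
  op_exp_defined (fun F => hinv (coefwise (Tlog dT) F)) F.

Variables (alpha : 'I_N -> 'I_2) (sqrtDelta : 'I_N -> K).

(* The product over a of tau_(alpha a) (hbar * sqrtDelta a, T^a). *)
Definition Delta_tau (tau : 'I_2 -> pseries K nat) : ser :=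
  to_hseries (\big[@pmul K idx/@pone K idx]_(a < N)
    (fun n => sqrtDelta a ^+ n *:
       rename (fun k : nat => (a, k)) (tau (alpha a) n))).

Definition ancestor (r : nat -> 'M[K]_N) (dT : 'I_N -> nat -> K)
    (tau : 'I_2 -> pseries K nat) : ser :=
  Rhat r (That dT (Delta_tau tau)).

Definition Lambda (dT : 'I_N -> nat -> K) (a : 'I_N) (m : int) (F : ser) :
    ser :=
  fun n =>
    let Ta := fun k : nat => (a, k) in
    tau_virasoro Ta (alpha a) (sqrtDelta a) m F n
    + 2^-1 *: \sum_(k \in [set k : nat | (1 + alpha a <= k)%N])
        ((oddfact (m + k%:Z + 1))%:R / (oddfact k)%:R * dT a k) *:
          fderiv Ta (m + k%:Z) (hinv F n).

Definition assoc_virasoro (r : nat -> 'M[K]_N) (dT : 'I_N -> nat -> K)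
    (a : 'I_N) (m : int) (F : ser) : ser :=
  Rhat r (Lambda dT a m (Rhat_inv r F)).

End Ancestor.

(* Main.v *)
From HB Require Import structures.
Require Import Defs.
From mathcomp Require Import all_boot all_order all_algebra finmap.
From mathcomp Require Import boolp classical_sets cardinality fsbigop.
From mathcomp Require Import reals complex monalg zify ring.

(** Conjugation by [Rhat] drops out because [exp (- Rlog)] inverts
    [exp Rlog], so it suffices that [Lambda] kills
    [That (prod_a tau_a) = exp (X / hbar) F], where [X] is [Tlog].  The operator
    annihilating the factor [tau_a] is
    [E - d / hbar], with [E] of order at most two and [d] a constant multiple
    of one derivation, and it annihilates the whole product [F] because the
    other factors do not involve the variables of index [a].  Since
    [X E = E X + Y] with [Y] commuting with [X], moving [E] through the
    exponential produces exactly the extra term [Y / hbar] of [Lambda].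

    For [exp (X / hbar) F] to make sense, give [T^a_k] the weight
    [(3 - 2 alpha_a) (2 k + 1)].  The Virasoro constraints determine all first
    derivatives of the coefficient of [hbar ^ (n + 1)] from that of [hbar ^ n],
    and hence bound the weight of the coefficient of [hbar ^ n] by [3 n].
    Each application of [X] lowers the weight by at least 5 (for [alpha_a = 1]
    this is where [dT a 1 = 0] enters), so [X ^ l] kills the coefficient of
    [hbar ^ (n + l)] as soon as [2 l > 3 n]. *)

Set Implicit Arguments.
Unset Strict Implicit.
Unset Printing Implicit Defensive.

Import Order.TTheory GRing.Theory Num.Theory.
Local Open Scope ring_scope.

(** * Finite-support sums and exponentials *)

Section FiniteSupportSums.

(* Eventually zero: on such families [\sum_(k \in D)] is a genuine sum. *)
Definition evz (V : nmodType) (f : nat -> V) : Prop :=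
  exists B, forall k, (B <= k)%N -> f k = 0.

Lemma evz_raddf (V W : nmodType) (phi : {additive V -> W}) (f : nat -> V) :
  evz f -> evz (fun k => phi (f k)).
Proof. by move=> [B fB]; exists B => k /fB ->; rewrite raddf0. Qed.

(** Computations with infinite sums pass through this truncation to a finite sum; several families
    are compared at a common bound. *)
Lemma fsum_le (V : nmodType) (B : nat) (D : set nat) (f : nat -> V) :
  (forall k, (B <= k)%N -> f k = 0) ->
  \sum_(k \in D) f k = \sum_(k < B | (k : nat) \in D) f k.
Proof.
move=> fB; rewrite fsbig_mkcond [RHS]big_mkcond /=.
rewrite -(big_mkord xpredT (fun k => if k \in D then f k else 0)) /=.
rewrite (@fsbigE _ _ _ _ _ (index_iota 0 B)) ?iota_uniq //.
  by apply: eq_big => k; rewrite ?in_setT.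
move=> k _; rewrite mem_index_iota /= -leqNgt => lBk.
by rewrite /functions.patch; case: ifP => // _; apply: fB.
Qed.

Lemma fsumD (V : nmodType) (D : set nat) (f g : nat -> V) :
  evz f -> evz g ->
  \sum_(k \in D) (f k + g k) = \sum_(k \in D) f k + \sum_(k \in D) g k.
Proof.
move=> [A fA] [B gB]; pose M := maxn A B.
have fM k : (M <= k)%N -> f k = 0 by rewrite geq_max => /andP[/fA].
have gM k : (M <= k)%N -> g k = 0 by rewrite geq_max => /andP[_ /gB].
rewrite !(fsum_le _ (B := M)) ?big_split // => k hk.
by rewrite fM // gM // addr0.
Qed.

Lemma raddf_fsum (V W : nmodType) (phi : {additive V -> W}) (D : set nat)
    (f : nat -> V) :
  evz f -> phi (\sum_(k \in D) f k) = \sum_(k \in D) phi (f k).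
Proof.
move=> [B fB]; rewrite !(fsum_le _ (B := B)) ?raddf_sum // => k /fB ->.
exact: raddf0.
Qed.

Lemma fsum_recl (V : nmodType) (f : nat -> V) :
  evz f -> \sum_(k \in setT) f k = f 0%N + \sum_(k \in setT) f k.+1.
Proof.
move=> [B fB]; rewrite (fsum_le _ (B := B.+1)); last by move=> k /ltnW/fB.
rewrite (fsum_le _ (B := B)); last by move=> k hk; apply/fB/leqW.
rewrite big_mkcond big_ord_recl /= in_setT [in RHS]big_mkcond.
by congr (_ + _); apply: eq_bigr => i _; rewrite !in_setT.
Qed.

Lemma fsum_linear (K : pzRingType) (V W : lmodType K) (D : set nat)
    (A : nat -> V -> W) :
  (forall k, linear (A k)) -> (forall p, evz (fun k => A k p)) ->
  linear (fun p => \sum_(k \in D) A k p).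
Proof.
move=> Alin Afin c p q.
have scl : evz (fun k => c *: A k p).
  exact: (evz_raddf (GRing.scale c) (Afin p)).
rewrite (raddf_fsum (GRing.scale c)) // -fsumD //.
by apply: eq_fsbigr => k _; rewrite Alin.
Qed.

End FiniteSupportSums.

(** * Exponentials of locally nilpotent operators *)

Section Exponentials.
Variables (K : numFieldType) (V : lmodType K).

Lemma iter_linear (A : {linear V -> V}) l : linear (iter l A).
Proof. by move=> c p q; elim: l => //= l ->; rewrite linearP. Qed.

HB.instance Definition _ (A : {linear V -> V}) l :=
  GRing.isLinear.Build K V V *:%R (iter l A) (iter_linear A l).

Lemma exp_opp_exp (A : {linear V -> V}) p :
  evz (fun l => iter l A p) ->
  \sum_(l \in setT)
    l`!%:R^-1 *: ((-1) ^+ l *: iter l A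
      (\sum_(k \in setT) k`!%:R^-1 *: iter k A p)) = p.
Proof.
move=> [B AB].
pose q := \sum_(k < B) k`!%:R^-1 *: iter k A p.
have -> : \sum_(k \in setT) k`!%:R^-1 *: iter k A p = q.
  rewrite (fsum_le _ (B := B)); last by move=> k /AB ->; rewrite scaler0.
  by rewrite /q; apply: eq_bigl => i; rewrite in_setT.
(* Reindexed by the total power [n = k + l], so that terms can be collected by powers of [A]. *)
have Aq l : iter l A q = \sum_(n < l + B | (l <= n)%N)
     (n - l)`!%:R^-1 *: iter n A p.
  rewrite /q linear_sum /=.
  rewrite -(big_mkord xpredT (fun i => iter l A (i`!%:R^-1 *: iter i A p))).
  rewrite -(big_mkord (leq l) (fun n => (n - l)`!%:R^-1 *: iter n A p)).
  rewrite [RHS](@big_cat_nat _ _ _ l) ?leq_addr //=.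
  rewrite [X in _ = X + _]big1_seq ?add0r.
    transitivity (\sum_(0 + l <= n < l + B | (l <= n)%N)
        (n - l)`!%:R^-1 *: iter n A p); last by rewrite add0n.
    rewrite big_addn addKn [RHS]big_mkcond; apply: eq_bigr => i _.
    by rewrite leq_addl addnK linearZ /= addnC iterD.
  move=> i; rewrite mem_index_iota => /andP[h1 /andP[_ h2]].
  by move: h1 h2; rewrite leqNgt => /negbTE ->.
(* Powers [n >= B] kill [p]; the range becomes independent of [l], which allows the two sums to be
   exchanged. *)
have AqB l : iter l A q = \sum_(n < B | (l <= n)%N)
     (n - l)`!%:R^-1 *: iter n A p.
  rewrite Aq -(big_mkord (leq l) (fun n => (n - l)`!%:R^-1 *: iter n A p)).
  rewrite [LHS](@big_cat_nat _ _ _ B) ?leq_addl //=.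
  rewrite [X in _ + X]big1_seq ?addr0 ?big_mkord //.
  move=> i; rewrite mem_index_iota => /andP[_ /andP[h _]].
  by rewrite AB // scaler0.
rewrite (fsum_le _ (B := B)); last first.
  move=> k hk; rewrite AqB big1 ?scaler0 // => i hi.
  by move: (ltn_ord i); rewrite ltnNge (leq_trans hk hi).
rewrite (eq_bigl xpredT); last by move=> i; rewrite in_setT.
under eq_bigr do rewrite AqB scalerA scaler_sumr big_mkcond.
rewrite exchange_big /=.
(* For [B = 0] already [p = iter 0 A p] is 0. Otherwise the term [n = 0] is [p] and the other terms
   vanish. *)
case: B AB @q Aq AqB => [|B] AB q Aq AqB.
  by rewrite big_ord0; move: (AB 0%N isT).
rewrite big_ord_recl /= [X in _ + X]big1 ?addr0.
  rewrite big_ord_recl /= big1 ?addr0 // subnn fact0 expr0 invr1 mulr1.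
  by rewrite !scale1r.
move=> n _; rewrite -[RHS](scale0r (iter (bump 0 n) A p)).
set N := bump 0 n.
under eq_bigr do [rewrite scalerA;
  rewrite -[X in if _ then _ else X](scale0r (iter N A p));
  rewrite -(fun_if (fun c => c *: iter N A p))].
rewrite -scaler_suml; congr (_ *: _).
have lN : (N < B.+1)%N by rewrite /N /bump /= ltnS.
rewrite -big_mkcond /=.
rewrite -(big_ord_widen B.+1
  (fun l => l`!%:R^-1 * (-1) ^+ l * (N - l)`!%:R^-1 : K) lN).
have fu k : (k`!%:R : K) != 0 by rewrite pnatr_eq0 -lt0n fact_gt0.
(* Multiplication by [N!] turns the coefficients into those of the binomial expansion of
   [(1 - 1) ^ N]. *)
apply: (mulfI (fu N)); rewrite mulr0 mulr_sumr.
rewrite -[RHS](_ : (1 - 1 : K) ^+ N = 0); last by rewrite subrr expr0n.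
rewrite exprBn; apply: eq_bigr => l _.
rewrite expr1n expr1n mulr1 mulr1 -mulr_natr.
rewrite -(bin_fact (m := l) (n := N)); last by rewrite -ltnS.
rewrite !natrM; have := fu l; have := fu (N - l)%N.
move: (l`!%:R) ((N-l)`!%:R) => x y hy hx; field.
by apply/andP.
Qed.

Lemma iter_commute_linear (X Z : {linear V -> V}) l p :
  (forall q, X (Z q) = Z (X q)) -> iter l X (Z p) = Z (iter l X p).
Proof. by move=> XZ; elim: l => //= l ->. Qed.

(** This is [[X ^ l, E] = l Y X ^ (l - 1)]: each passage of an [X] across [E] leaves one [Y], which
    commutes with the remaining factors. At [l = 0] the factor [l] makes the truncated [l.-1]
    harmless. *)
Lemma iter_commutator (X E Y : {linear V -> V}) l p :
  (forall q, X (E q) = E (X q) + Y q) -> (forall q, X (Y q) = Y (X q)) ->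
  iter l X (E p) = E (iter l X p) + l%:R *: Y (iter l.-1 X p).
Proof.
move=> XE XY; elim: l => [|l IHl] /=; first by rewrite scale0r addr0.
rewrite IHl linearD XE linearZ /= XY -addrA; congr (_ + _).
case: l {IHl} => [|l]; first by rewrite scale0r addr0 scale1r.
by rewrite -[in RHS]addn1 natrD scalerDl scale1r addrC.
Qed.

(* The operators [d] and [Y] come with a factor [1 / hbar], hence the shift of
   the index [n]. *)
Lemma exp_intertwine (X E Y d : {linear V -> V}) (F : int -> V) :
  (forall q, X (E q) = E (X q) + Y q) ->
  (forall q, X (Y q) = Y (X q)) -> (forall q, X (d q) = d (X q)) ->
  (forall n, E (F n) = d (F (n + 1))) ->
  (forall n, evz (fun l => iter l X (F (n + l%:Z)))) ->
  let G n := \sum_(l \in setT) l`!%:R^-1 *: iter l X (F (n + l%:Z)) in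
  forall n, E (G n) + Y (G (n + 1)) = d (G (n + 1)).
Proof.
move=> XE XY Xd EF Ffin G n.
have Gfin m : evz (fun l => l`!%:R^-1 *: iter l X (F (m + l%:Z))).
  by have [B hB] := Ffin m; exists B => k /hB ->; rewrite scaler0.
(* The commutator term of order [l]. Since [l / l! = 1 / (l - 1)!], [g l.+1] is the term of order
   [l] in [Y (G (n + 1))], and [g 0] is 0. *)
pose g l := l`!%:R^-1 *: (l%:R *: Y (iter l.-1 X (F (n + l%:Z)))).
have gS l : Y (l`!%:R^-1 *: iter l X (F (n + 1 + l%:Z))) = g l.+1.
  rewrite /g /= linearZ /= scalerA factS natrM invfM mulrAC mulVf ?mul1r.
    by congr (_ *: Y (iter _ _ (F _))); lia.
  by rewrite pnatr_eq0.
have gfin : evz g.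
  have [B hB] := Gfin (n + 1); exists B.+1 => -[|k] // hk.
  by rewrite -gS hB // linear0.
have EGfin := evz_raddf E (Gfin n).
rewrite /G (raddf_fsum E) // (raddf_fsum Y) // (raddf_fsum d) //.
have -> : \sum_(l \in setT) Y (l`!%:R^-1 *: iter l X (F (n + 1 + l%:Z))) =
    \sum_(l \in setT) g l.
  rewrite (fsum_recl gfin) /g scale0r scaler0 add0r.
  by apply: eq_fsbigr => l _; exact: gS.
rewrite -fsumD //.
apply: eq_fsbigr => l _.
rewrite /= !linearZ /= -scalerDr -iter_commutator // EF iter_commute_linear //.
by congr (_ *: d (iter _ _ (F _))); lia.
Qed.

End Exponentials.

(** * Derivatives, weights and renaming in C[T] *)

Section Derivations.
Variables (K : fieldType) (I : choiceType).
Implicit Types (p q : tpoly K I) (i j : I) (m : {cmonom I}).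

Lemma mcoeff_tderiv i p m : (tderiv i p)@_m = p@_(mmul m (ucm i)) *+ (m i).+1.
Proof.
rewrite /tderiv raddf_sum /=.
(* [divcm] truncates, so the equivalence needs [0 < x i]; monomials free of [i] enter the derivative
   with multiplicity 0. *)
have eqm (x : {cmonom I}) : (0 < x i)%N ->
    (divcm x (ucm i) == m) = (x == mmul m (ucm i)).
  move=> xi; apply/eqP/eqP => [<-|->]; apply/eqP/cmP => j.
    rewrite cmM divcmE ucmE subnK //; case: eqVneq => // <- //.
  by rewrite divcmE cmM ucmE addnK.
transitivity (\sum_(x <- msupp p)
    if x == mmul m (ucm i) then p@_(mmul m (ucm i)) *+ (m i).+1 else 0).
  apply: eq_bigr => x _; rewrite mcoeffU.
  case: (posnP (x i)) => xi.
    rewrite xi mulr0n mul0rn; case: eqP => // xm.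
    by move: xi; rewrite xm cmM ucmE eqxx addn1.
  rewrite eqm //; case: eqP => // ->; rewrite mulr1n.
  by rewrite cmM ucmE eqxx addn1.
case: (msuppP p (mmul m (ucm i))) => h.
  rewrite (big_fsetD1 _ h) /= eqxx big_seq big1 ?addr0 // => x.
  by rewrite in_fsetD1 => /andP[/negbTE ->].
by rewrite big1 ?mul0rn // => x _; rewrite if_same.
Qed.

(* The instances of [mcoeffD] and [mcoeffZ] at [tpoly]: rewriting with the
   general lemmas makes unification unfold the algebra structure of [malg]. *)
Lemma tcoeffD p q m : (p + q)@_m = p@_m + q@_m.
Proof. exact: mcoeffD. Qed.

Lemma tcoeffZ (c : K) p m : (c *: p)@_m = c * p@_m.
Proof. exact: mcoeffZ. Qed.

Lemma tderiv_linear i : linear (@tderiv K I i).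
Proof.
move=> c p q.
have := mcoeff_tderiv i (c *: p + q); have := mcoeff_tderiv i p.
have := mcoeff_tderiv i q.
move: (tderiv i (c *: p + q)) (tderiv i p) (tderiv i q) => x y z hz hy hx.
apply/malgP => m.
by rewrite tcoeffD tcoeffZ hx hy hz tcoeffD tcoeffZ mulrnDl mulrnAr.
Qed.

HB.instance Definition _ i :=
  GRing.isLinear.Build K (tpoly K I) (tpoly K I) *:%R (@tderiv K I i)
    (tderiv_linear i).

Lemma mcoeff_tvarM i p m :
  (tvar i * p)@_(mmul m (ucm i)) = p@_m.
Proof.
rewrite mulrC [p in LHS]monalgE mulr_suml raddf_sum /=.
rewrite [p in RHS]monalgE raddf_sum /=; apply: eq_bigr => x _.
rewrite /tvar malgM_def fgmulUU !mcoeffU mulr1; congr (_ *+ nat_of_bool _).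
apply/eqP/eqP => [/eqP/cmP h|-> //]; apply/eqP/cmP => j.
by have := h j; rewrite !cmM => /addIn.
Qed.

Lemma mcoeff_tvarM0 i p m : m i = 0%N -> (tvar i * p)@_m = 0.
Proof.
move=> mi; rewrite [p]monalgE mulr_sumr raddf_sum big1 //= => x _.
rewrite /tvar malgM_def fgmulUU mcoeffU; case: eqP => // xm.
by move: mi; rewrite -xm cmM ucmE eqxx.
Qed.

Lemma monom_split m i : (0 < m i)%N -> m = mmul (divcm m (ucm i)) (ucm i).
Proof.
move=> mi; apply/eqP/cmP => j.
by rewrite cmM divcmE ucmE subnK //; case: eqVneq => // <-.
Qed.

Lemma monom_neq1 m : m != mone -> exists i, (0 < m i)%N.
Proof.
move=> m1; apply: contrapT => h; case/negP: m1; apply/cmP => i.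
by rewrite cm1; case: (posnP (m i)) => // mi; case: h; exists i.
Qed.

(** Monomials are reached from 1 by adding one variable factor at a time, by induction on the total
    degree. *)
Lemma tpoly_ind (P : tpoly K I -> Prop) :
  (forall c p q, P p -> P q -> P (c *: p + q)) ->
  P 1 -> (forall i p, P p -> P (tvar i * p)) -> forall p, P p.
Proof.
move=> Plin P1 Pvar p.
have P0 : P 0 by rewrite -(addNr 1) -scaleN1r; apply: Plin.
have Pm n m : mdeg m = n -> P << m >>.
  elim: n m => [|n IHn] m.
    by move/mdeg_eq0I ->.
  move=> dm; have : m != mone by rewrite -mdeg_eq0 dm.
  move=> /monom_neq1 [i mi].
  have em := monom_split mi.
  have -> : << m >> = tvar i * << divcm m (ucm i) >> :> tpoly K I.
    by rewrite mulrC /tvar malgM_def fgmulUU mulr1 -em.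
  apply/Pvar/IHn; move: dm; rewrite {1}em mdegM mdegU addn1.
  by case.
rewrite [p]monalgE; elim: (msupp p : seq _) => [|m s IHs].
  by rewrite big_nil.
rewrite big_cons; have -> : << p@_m *g m >> = p@_m *: << m >> :> tpoly K I.
  apply/malgP => x; apply: etrans (esym (tcoeffZ _ _ _)).
  apply: etrans (mcoeffU _ _ _) _.
  by rewrite (mcoeffU m 1) mulrnAr mulr1.
exact: Plin (Pm _ _ (erefl _)) IHs.
Qed.

Lemma tderiv_tvarM i j p :
  tderiv i (tvar j * p) = p *+ (i == j) + tvar j * tderiv i p.
Proof.
have := mcoeff_tderiv i (tvar j * p); have := mcoeff_tderiv i p.
move: (tderiv i (tvar j * p)) (tderiv i p) => x y hy hx.
apply/malgP => m; rewrite tcoeffD mcoeffMn hx.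
case: (eqVneq i j) => [<-|ij].
  rewrite mcoeff_tvarM mulr1n; case: (posnP (m i)) => mi.
    by rewrite mi mulr1n mcoeff_tvarM0 // addr0.
  rewrite {4}(monom_split mi) mcoeff_tvarM hy -monom_split //.
  by rewrite divcmE ucmE eqxx subn1 prednK // mulrS.
rewrite mulr0n add0r; case: (posnP (m j)) => mj.
  rewrite !mcoeff_tvarM0 ?mul0rn //.
  by rewrite cmM mj ucmE (negbTE ij).
have -> : mmul m (ucm i) = mmul (mmul (divcm m (ucm j)) (ucm i)) (ucm j).
  by rewrite {1}(monom_split mj) -!mulmA [mmul (ucm j) _]mulmC.
rewrite (mcoeff_tvarM j p) [in RHS](monom_split mj) (mcoeff_tvarM j y) hy.
by rewrite divcmE ucmE eq_sym (negbTE ij) subn0.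
Qed.

Lemma tderiv1 i : tderiv i (1 : tpoly K I) = 0.
Proof.
apply/malgP => m; rewrite mcoeff_tderiv mcoeff1 mcoeff0.
case: eqP => [/(congr1 (fun x : {cmonom I} => x i))|_]; last by rewrite mul0rn.
by rewrite cmM cm1 ucmE eqxx addn1.
Qed.

End Derivations.

(** * Weighted degree of polynomials *)

Section Weights.
Variables (K : numFieldType) (I : choiceType) (w : I -> nat).
Implicit Types (p q : tpoly K I) (i : I) (m : {cmonom I}) (d e : int).

Definition weight m : nat := \sum_(i <- finsupp m) m i * w i.

Lemma weightEw m (D : {fset I}) :
  (finsupp m `<=` D)%fset -> weight m = (\sum_(i <- D) m i * w i)%N.
Proof.
move=> le; rewrite /weight (big_fset_incl _ le) // => i _.
by rewrite -cmE_neq0 negbK => /eqP ->; rewrite mul0n.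
Qed.

Lemma weightM m1 m2 : weight (mmul m1 m2) = (weight m1 + weight m2)%N.
Proof.
rewrite (@weightEw (mmul m1 m2) (finsupp m1 `|` finsupp m2)%fset) ?mdomD //.
rewrite (weightEw (fsubsetUl (finsupp m1) (finsupp m2))).
rewrite (weightEw (fsubsetUr (finsupp m1) (finsupp m2))).
by rewrite -big_split /=; apply: eq_bigr => i _; rewrite cmM mulnDl.
Qed.

Lemma weightU i : weight (ucm i) = w i.
Proof. by rewrite /weight mdomU big_seq_fset1 cmUU mul1n. Qed.

Lemma weight1 : weight mone = 0%N.
Proof. by rewrite /weight mdom1 big_seq_fset0. Qed.

Definition wle d p : Prop := forall m, p@_m != 0 -> (weight m)%:Z <= d.

Lemma wle_lin d (c : K) p q : wle d p -> wle d q -> wle d (c *: p + q).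
Proof.
move=> hp hq m; rewrite tcoeffD tcoeffZ => h.
case: (eqVneq p@_m 0) => [p0|/hp //]; apply: hq.
by apply: contraNneq h => ->; rewrite p0 mulr0 addr0.
Qed.

Lemma wle_trans d e p : d <= e -> wle d p -> wle e p.
Proof. by move=> de hp m /hp h; apply: le_trans de. Qed.

(** Weights are natural numbers. Hence an operator that lowers the bound by a fixed positive amount
    is locally nilpotent. *)
Lemma wle_neg d p : d < 0 -> wle d p -> p = 0.
Proof.
move=> d0 hp; apply/malgP => m; apply: etrans (esym (mcoeff0 m)).
apply: contraTeq d0 => /hp h; rewrite -leNgt; apply: le_trans h.
by [].
Qed.

Lemma wle0 d : wle d (0 : tpoly K I).
Proof. by move=> m; rewrite mcoeff0 eqxx. Qed.

Lemma wle1 : wle 0 (1 : tpoly K I).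
Proof.
move=> m; rewrite mcoeff1; case: (eqVneq m mone) => [-> _|_].
  by rewrite weight1.
by rewrite mulr0n eqxx.
Qed.

Lemma wle_tvar i : wle (w i)%:Z (tvar i : tpoly K I).
Proof.
move=> m; rewrite /tvar mcoeffU; case: (eqVneq (ucm i) m) => [<- _|_].
  by rewrite weightU.
by rewrite mulr0n eqxx.
Qed.

Lemma wleM d e p q : wle d p -> wle e q -> wle (d + e) (p * q).
Proof.
move=> hp hq m; rewrite mcoeff_neq0 => /msuppM_le [m1 [m2 [h1 h2 ->]]].
rewrite weightM PoszD lerD //; [apply: hp|apply: hq]; by rewrite mcoeff_neq0.
Qed.

Lemma wle_tderiv d i p : wle d p -> wle (d - (w i)%:Z) (tderiv i p).
Proof.
move=> hp m; rewrite (mcoeff_tderiv i p) => h.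
rewrite lerBrDr -PoszD -weightU -weightM; apply: hp.
by apply: contraNneq h => ->; rewrite mul0rn.
Qed.

(** A nonconstant monomial contains some variable [i] and leaves a trace in the derivative along
    [i], its exponent being nonzero in characteristic 0. The constant term is covered by
    [0 <= d]. *)
Lemma wle_of_tderiv d p : 0 <= d ->
  (forall i, wle (d - (w i)%:Z) (tderiv i p)) -> wle d p.
Proof.
move=> d0 hp m pm; case: (eqVneq m mone) => [->|/monom_neq1 [i mi]].
  by rewrite weight1.
have em := monom_split mi.
have /hp : (tderiv i p)@_(divcm m (ucm i)) != 0.
  by rewrite (mcoeff_tderiv i p) -em mulrn_eq0 negb_or.
by rewrite lerBrDr -PoszD -weightU -weightM -em.
Qed.

End Weights.

Section Rename.
Variables (K : numFieldType) (I J : choiceType) (v : I -> J).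

Let h (m : {cmonom I}) : tpoly K J :=
  \prod_(k <- finsupp (cmonom_val m)) tvar (v k) ^+ m k.

Let hEw (m : {cmonom I}) (D : {fset I}) : (finsupp m `<=` D)%fset ->
  h m = \prod_(k <- D) tvar (v k) ^+ m k.
Proof.
move=> le; rewrite /h (big_fset_incl _ le) // => i _.
by rewrite -cmE_neq0 negbK => /eqP ->; rewrite expr0.
Qed.

Let h_mul : mmorphism h.
Proof.
split=> [m1 m2|].
  rewrite (@hEw (mmul m1 m2) (finsupp m1 `|` finsupp m2)%fset) ?mdomD //.
  rewrite (hEw (fsubsetUl (finsupp m1) (finsupp m2))).
  rewrite (hEw (fsubsetUr (finsupp m1) (finsupp m2))).
  by rewrite -big_split /=; apply: eq_bigr => i _; rewrite cmM exprD.
by rewrite /h mdom1 big_seq_fset0.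
Qed.

HB.instance Definition _ :=
  isMultiplicative.Build {cmonom I} (tpoly K J) h h_mul.

Lemma rename1 : rename v (1 : tpoly K I) = 1.
Proof. exact: (mmap1 (f := @malgC _ K) (h := h)). Qed.

Lemma rename_linear (c : K) (p q : tpoly K I) :
  rename v (c *: p + q) = c *: rename v p + rename v q.
Proof.
apply: etrans (mmapD (f := @malgC _ K) (h := h) (c *: p) q) _.
by congr (_ + _); apply: etrans (mmapZ c p) _; apply: mul_malgC.
Qed.

Lemma rename_tvarM i (p : tpoly K I) :
  rename v (tvar i * p) = tvar (v i) * rename v p.
Proof.
have := (mmap_is_multiplicative (f := @malgC _ K) (h := h)).1 (tvar i) p.
move=> mul; apply: etrans mul _.
congr (_ * _); apply: etrans (mmapU _ _) _.
have hU : h (ucm i) = tvar (v i).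
  by rewrite (hEw (D := [fset i]%fset)) ?mdomU // big_seq_fset1 cmUU expr1.
by apply: etrans (congr1 ( *%R _) hU) _; exact: mul1r.
Qed.

End Rename.

Lemma fsum_single (V : nmodType) (k : nat) (f : nat -> V) :
  (forall j, j != k -> f j = 0) -> \sum_(j \in setT) f j = f k.
Proof.
move=> fk; rewrite (@fsbigE _ _ _ _ _ [:: k]) //=.
  by rewrite big_cons big_nil in_setT addr0.
by move=> j _; rewrite inE => /fk.
Qed.

(** * Operators on an abstract polynomial algebra *)

(* The interface through which C[T] is used below; [pdeg w d p] says that all
   monomials of [p] have [w]-weight at most [d].  Working over an
   abstract algebra keeps unification from unfolding the operations of
   [malg]. *)
Record polycalc (K : numFieldType) (I : choiceType) (A : comAlgType K) :=
  PolyCalc {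
    pvar : I -> A;
    pder : I -> {linear A -> A};
    pdeg : (I -> nat) -> int -> A -> Prop;
    pc_ind : forall P : A -> Prop,
      (forall (c : K) p q, P p -> P q -> P (c *: p + q)) ->
      P 1 -> (forall i p, P p -> P (pvar i * p)) -> forall p, P p;
    pder1 : forall i, pder i 1 = 0;
    pder_var : forall i j p,
      pder i (pvar j * p) = p *+ (i == j) + pvar j * pder i p;
    pdeg0 : forall w d, pdeg w d 0;
    pdeg_lin : forall w d (c : K) p q,
      pdeg w d p -> pdeg w d q -> pdeg w d (c *: p + q);
    pdeg_trans : forall w d e p, d <= e -> pdeg w d p -> pdeg w e p;
    pdeg_neg : forall w d p, d < 0 -> pdeg w d p -> p = 0;
    pdeg1 : forall w, pdeg w 0 1;
    pdeg_var : forall w i, pdeg w (w i)%:Z (pvar i);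
    pdegM : forall w d e p q,
      pdeg w d p -> pdeg w e q -> pdeg w (d + e) (p * q);
    pdeg_der : forall w d i p, pdeg w d p -> pdeg w (d - (w i)%:Z) (pder i p);
    pdeg_of_der : forall w d p, 0 <= d ->
      (forall i, pdeg w (d - (w i)%:Z) (pder i p)) -> pdeg w d p
  }.

Arguments pc_ind {K I A} _ _ _ _ _ _.
Arguments pdeg0 {K I A} _ _ _.

Section PolyCalculus.
Variables (K : numFieldType) (I : choiceType) (A : comAlgType K).
Variable C : polycalc I A.
Local Notation X := (pvar C).
Local Notation D := (pder C).
Local Notation deg := (pdeg C).
Implicit Types (p q : A) (w : I -> nat) (d e : int).

Lemma pder_mul i p q : D i (p * q) = D i p * q + p * D i q.
Proof.
elim/(pc_ind C): p => [c p p' IHp IHp'||j p IHp].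
- rewrite mulrDl -scalerAl !linearP /= IHp IHp' !mulrDl -!scalerAl scalerDr.
  by rewrite addrACA.
- by rewrite pder1 !mul1r mul0r add0r.
- rewrite -mulrA !pder_var IHp mulrDr mulrDl !mulrA addrA; congr (_ + _ + _).
  by rewrite mulrnAl.
Qed.

Lemma pderC i j p : D i (D j p) = D j (D i p).
Proof.
elim/(pc_ind C): p => [c p p' IHp IHp'||k p IHp].
- by rewrite !linearP /= IHp IHp'.
- by rewrite !pder1 !linear0.
- by rewrite !pder_var !linearD /= !linearMn /= !pder_var IHp addrCA.
Qed.

Lemma pder_fin p : exists s : seq I, forall i, i \notin s -> D i p = 0.
Proof.
elim/(pc_ind C): p => [c p p' [s hs] [t ht]||k p [s hs]].
- exists (s ++ t) => i; rewrite mem_cat negb_or => /andP[/hs hi /ht ti].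
  by rewrite linearP /= hi ti scaler0 addr0.
- by exists [::] => i _; exact: pder1.
- exists (k :: s) => i; rewrite inE negb_or => /andP[/negbTE ik /hs hi].
  by rewrite pder_var ik hi mulr0 addr0.
Qed.

(** A polynomial involves finitely many variables. With [lev = snd] the bound on [k] is uniform over
    the families, so the sums over [k] below are finite. *)
Lemma pder_level (lev : I -> nat) p :
  exists B, forall i, (B <= lev i)%N -> D i p = 0.
Proof.
have [s hs] := pder_fin p; exists (\max_(i <- s) lev i).+1 => i hi.
apply: hs; apply/negP => /(@leq_bigmax_seq _ s xpredT lev) /(_ isT).
by rewrite leqNgt hi.
Qed.

Lemma pdegD w d p q : deg w d p -> deg w d q -> deg w d (p + q).
Proof. by move=> hp hq; rewrite -[p]scale1r; apply: pdeg_lin. Qed.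

Lemma pdegZ w d (c : K) p : deg w d p -> deg w d (c *: p).
Proof. by move=> hp; rewrite -[X in deg w d X]addr0; apply/pdeg_lin/pdeg0. Qed.

Lemma pdeg_sum w d (T : Type) (s : seq T) (P : pred T) (f : T -> A) :
  (forall x, P x -> deg w d (f x)) -> deg w d (\sum_(x <- s | P x) f x).
Proof.
move=> hf; apply: big_ind => //; [exact: pdeg0|by move=> p q; apply: pdegD].
Qed.

(** A sum with infinite support is 0 by convention, which satisfies every bound, so both cases are
    covered. *)
Lemma pdeg_fsum w d (S : set nat) (f : nat -> A) :
  (forall k, S k -> deg w d (f k)) -> deg w d (\sum_(k \in S) f k).
Proof.
move=> hf; rewrite big_seq; apply: pdeg_sum => k.
by case: finite_supportP => // s sS _ _ /sS/hf.
Qed.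

Lemma pdeg_exists w p : exists d, deg w d p.
Proof.
elim/(pc_ind C): p => [c p p' [d hd] [e he]||k p [d hd]].
- exists (Num.max d e); apply: pdeg_lin.
    by apply: pdeg_trans hd; rewrite le_max lexx.
  by apply: pdeg_trans he; rewrite le_max lexx orbT.
- by exists 0; apply: pdeg1.
- by exists ((w k)%:Z + d); apply/pdegM/hd/pdeg_var.
Qed.

Lemma pdeg_iter w d e (Z : A -> A) l p :
  (forall f q, deg w f q -> deg w (f - e) (Z q)) ->
  deg w d p -> deg w (d - l%:Z * e) (iter l Z p).
Proof.
move=> hZ hp; elim: l => [|l IHl] /=; first by rewrite mul0r subr0.
by have := hZ _ _ IHl; congr (deg w _ _); lia.
Qed.

(** * Virasoro operators in one family of variables *)

Section Virasoro.
Variable v : nat -> I.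

Definition afderiv (k : int) p : A := if k is Posz n then D (v n) p else 0.

Lemma afderiv_linear k : linear (afderiv k).
Proof. by case: k => n c p q; rewrite /= ?linearP // scaler0 addr0. Qed.

HB.instance Definition _ k :=
  GRing.isLinear.Build K A A *:%R (afderiv k) (afderiv_linear k).

Definition avirasoro (m : int) p : A :=
  2^-1 *: (\sum_(i < `|m|.+1) \sum_(j < `|m|.+1 | i%:Z + j%:Z == - m - 1)
             ((oddfact i)%:R * (oddfact j)%:R)^-1 *:
               (X (v i) * (X (v j) * p)))
  + \sum_(k \in [set: nat])
      ((oddfact (k%:Z + m + 1))%:R / (oddfact k)%:R) *:
        (X (v k) * afderiv (k%:Z + m) p)
  + 2^-1 *: (\sum_(i < `|m|.+1) \sum_(j < `|m|.+1 | i%:Z + j%:Z == m - 1)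
               ((oddfact (i%:Z + 1))%:R * (oddfact (j%:Z + 1))%:R) *:
                 D (v i) (D (v j) p)).

Variable lev : I -> nat.
Hypothesis levK : cancel v lev.

Lemma afderiv_level p : exists B : nat, forall k : int,
  B%:Z <= k -> afderiv k p = 0.
Proof.
have [B hB] := pder_level lev p; exists B => -[k|k] //= hk.
by apply: hB; rewrite levK.
Qed.

Lemma afderiv_shift_evz m p (f : nat -> A -> A) :
  (forall k, f k 0 = 0) -> evz (fun k => f k (afderiv (k%:Z + m) p)).
Proof.
move=> f0; have [B hB] := afderiv_level p; exists (B + `|m|)%N => k hk.
by rewrite hB ?f0 //; lia.
Qed.

Lemma virasoro_mid_evz m p :
  evz (fun k => ((oddfact (k%:Z + m + 1))%:R / (oddfact k)%:R : K) *:
        (X (v k) * afderiv (k%:Z + m) p)).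
Proof.
apply: (afderiv_shift_evz _ _ (f := fun k q =>
  ((oddfact (k%:Z + m + 1))%:R / (oddfact k)%:R : K) *: (X (v k) * q))).
by move=> k; rewrite mulr0 scaler0.
Qed.

(** With weight [g (2 k + 1)] for [T_k] the operator is homogeneous: [T_i T_j] with
    [i + j = - m - 1], [T_k d/dT_(k+m)] and the second derivatives with [i + j = m - 1] all shift
    the weight by [- 2 g m]. *)
Lemma avirasoro_deg w (g : nat) d m p :
  (forall k, w (v k) = (g * (2 * k + 1))%N) ->
  deg w d p -> deg w (d - (2 * g)%:Z * m) (avirasoro m p).
Proof.
move=> hw hp; apply: pdegD; first apply: pdegD.
- apply/pdegZ/pdeg_sum => i _; apply: pdeg_sum => j /eqP ij; apply: pdegZ.
  rewrite -(_ : (w (v i))%:Z + ((w (v j))%:Z + d) = d - (2 * g)%:Z * m).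
    by do 2!(apply: pdegM; first exact: pdeg_var).
  by rewrite !hw; nia.
- apply: pdeg_fsum => k _; apply: pdegZ.
  case kE : (k%:Z + m) => [l|l] /=; last by rewrite mulr0; apply: pdeg0.
  rewrite -(_ : (w (v k))%:Z + (d - (w (v l))%:Z) = d - (2 * g)%:Z * m).
    by apply: pdegM; [exact: pdeg_var|exact: pdeg_der].
  by rewrite !hw; nia.
- apply/pdegZ/pdeg_sum => i _; apply: pdeg_sum => j /eqP ij; apply: pdegZ.
  rewrite -(_ : d - (w (v j))%:Z - (w (v i))%:Z = d - (2 * g)%:Z * m).
    by do 2!apply: pdeg_der.
  by rewrite !hw; nia.
Qed.

Lemma avirasoro_linear m : linear (avirasoro m).
Proof.
pose cr (i j : nat) : K := ((oddfact i)%:R * (oddfact j)%:R)^-1.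
pose an (i j : nat) : K :=
  (oddfact (i%:Z + 1))%:R * (oddfact (j%:Z + 1))%:R.
have mid : linear (fun p => \sum_(k \in [set: nat])
    ((oddfact (k%:Z + m + 1))%:R / (oddfact k)%:R) *:
        (X (v k) * afderiv (k%:Z + m) p)).
  apply: fsum_linear => [k c p q|p]; last exact: virasoro_mid_evz.
  by rewrite linearP mulrDr -scalerAr scalerDr !scalerA mulrC.
have sl (P : nat -> nat -> bool) (a : nat -> nat -> K)
    (f : nat -> nat -> A -> A) : (forall i j, linear (f i j)) ->
  linear (fun p => 2^-1 *: \sum_(i < `|m|.+1) \sum_(j < `|m|.+1 | P i j)
      a i j *: f i j p).
  move=> fl c p q; rewrite scalerA mulrC -scalerA -scalerDr; congr (_ *: _).
  rewrite scaler_sumr -big_split /=; apply: eq_bigr => i _.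
  rewrite scaler_sumr -big_split /=; apply: eq_bigr => j _.
  by rewrite fl scalerDr !scalerA mulrC.
move=> c p q; rewrite /avirasoro mid.
rewrite (sl (fun i j : nat => i%:Z + j%:Z == - m - 1) cr
  (fun (i j : nat) p => X (v i) * (X (v j) * p)))
  => [|i j c' p' q']; last first.
  by rewrite !mulrDr -!scalerAr.
rewrite (sl (fun i j : nat => i%:Z + j%:Z == m - 1) an
  (fun (i j : nat) p => D (v i) (D (v j) p))) => [|i j c' p' q']; last first.
  by rewrite !linearP.
by rewrite !scalerDr [RHS]addrACA; congr (_ + _); exact: addrACA.
Qed.

Lemma avirasoro0 m : avirasoro m 0 = 0.
Proof.
by have := avirasoro_linear m (-1) 0 0; rewrite scaler0 addr0 scaleN1r addNr.
Qed.

(** For [m >= -1] the quadratic part is at most a multiple of [T_0 ^ 2], which a derivative with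
    [k > 0] does not see. The commutator thus comes from the single term [T_k d/dT_(k+m)] of the
    middle sum. *)
Lemma avirasoro_commute_pder (k : nat) m p : (0 < k)%N -> -1 <= m ->
  D (v k) (avirasoro m p) =
  avirasoro m (D (v k) p)
  + ((oddfact (m + k%:Z + 1))%:R / (oddfact k)%:R) *: afderiv (m + k%:Z) p.
Proof.
move=> k0 m1; rewrite /avirasoro [LHS]linearD [D _ (_ + _)]linearD !linearZ /=.
rewrite [RHS]addrAC; congr (_ + _); last first.
  congr (_ *: _); rewrite linear_sum; apply: eq_bigr => i _.
  rewrite linear_sum; apply: eq_bigr => j _; rewrite linearZ /=.
  by rewrite pderC; congr (_ *: D _ _); rewrite pderC.
rewrite -addrA; congr (_ + _).
  congr (_ *: _); rewrite linear_sum; apply: eq_bigr => i _.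
  rewrite linear_sum; apply: eq_bigr => j /eqP ij; rewrite linearZ /=.
  have [ki kj] : (k == i :> nat) = false /\ (k == j :> nat) = false by lia.
  by rewrite !pder_var !(inj_eq (can_inj levK)) ki kj !add0r.
rewrite raddf_fsum; last exact: virasoro_mid_evz.
(* The commutator written as a family supported at [j = k], so that it can be added termwise to the
   middle sum. *)
pose y (j : nat) : A := ((oddfact (j%:Z + m + 1))%:R / (oddfact j)%:R) *:
  (afderiv (j%:Z + m) p *+ (k == j)).
have y0 j : j != k -> y j = 0.
  by move=> jk; rewrite /y eq_sym (negbTE jk) scaler0.
rewrite [m + _]addrC -[X in _ + X](_ : y k = _); last by rewrite /y eqxx.
rewrite -(fsum_single y0) -fsumD; [|exact: virasoro_mid_evz|]; last first.
  by exists k.+1 => j kj; apply: y0; rewrite gtn_eqF.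
apply: eq_fsbigr => j _; rewrite /= linearZ /= -scalerDr; congr (_ *: _).
rewrite pder_var (inj_eq (can_inj levK)) addrC; congr (_ * _ + _).
by case: (j%:Z + m) => l /=; rewrite ?linear0 // pderC.
Qed.

End Virasoro.
End PolyCalculus.

Arguments avirasoro : simpl never.

Section Intertwining.
Variables (K : numFieldType) (I J : choiceType) (A B : comAlgType K).
Variables (C : polycalc I A) (E : polycalc J B).
Variables (v : nat -> I) (lev : I -> nat) (levK : cancel v lev) (u : nat -> J).
Variable phi : {linear A -> B}.
Hypothesis phi_var : forall k p, phi (pvar C (v k) * p) = pvar E (u k) * phi p.
Hypothesis phi_der : forall k p, phi (pder C (v k) p) = pder E (u k) (phi p).

Lemma afderiv_intertwine k p : phi (afderiv C v k p) = afderiv E u k (phi p).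
Proof. by case: k => k //=; rewrite linear0. Qed.

(** Used below with [phi] a derivative in another family, the multiplication by a polynomial free of
    the family, and the renaming of variables. *)
Lemma avirasoro_intertwine m p :
  phi (avirasoro C v m p) = avirasoro E u m (phi p).
Proof.
rewrite /avirasoro [LHS]linearD [phi (_ + _)]linearD !linearZ /=.
congr (_ + _ + _).
- congr (_ *: _); rewrite linear_sum; apply: eq_bigr => i _.
  rewrite linear_sum; apply: eq_bigr => j _; rewrite linearZ /=.
  by rewrite !phi_var.
- rewrite raddf_fsum; last exact: (virasoro_mid_evz C levK).
  apply: eq_fsbigr => k _; rewrite /= linearZ /= phi_var.
  by rewrite afderiv_intertwine.
- congr (_ *: _); rewrite linear_sum; apply: eq_bigr => i _.
  rewrite linear_sum; apply: eq_bigr => j _; rewrite linearZ /=.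
  by rewrite !phi_der.
Qed.

End Intertwining.

Lemma linear_id (K : pzRingType) (V : lmodType K) : linear (@id V).
Proof. by []. Qed.

Lemma linear_add (K : pzRingType) (V W : lmodType K) (f g : V -> W) :
  linear f -> linear g -> linear (fun p => f p + g p).
Proof. by move=> hf hg c p q; rewrite hf hg scalerDr addrACA. Qed.

Lemma linear_scale (K : comPzRingType) (V W : lmodType K) (c : K) (f : V -> W) :
  linear f -> linear (fun p => c *: f p).
Proof. by move=> hf b p q; rewrite hf scalerDr !scalerA mulrC. Qed.

Lemma linear_sum_fun (K : pzRingType) (V W : lmodType K) (T : Type) (s : seq T)
    (P : pred T) (f : T -> V -> W) :
  (forall x, linear (f x)) -> linear (fun p => \sum_(x <- s | P x) f x p).
Proof.
move=> hf c p q; rewrite scaler_sumr -big_split /=.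
by apply: eq_bigr => x _; rewrite hf.
Qed.

Lemma oddfact_neq0 (K : numFieldType) k : (oddfact k)%:R != 0 :> K.
Proof.
rewrite pnatr_eq0 -lt0n; case: k => //= n.
by elim/big_ind: _ => // [m1 m2 h1 h2|i _]; [rewrite muln_gt0 h1|rewrite addn1].
Qed.

Section Operators.
Variables (K : numFieldType) (N : nat).
Local Notation idx := ('I_N * nat)%type.
Variables (A : comAlgType K) (C : polycalc idx A).
Local Notation X := (pvar C).
Local Notation D := (pder C).
Local Notation deg := (pdeg C).
Implicit Types (p q : A) (w : idx -> nat) (d e : int).

Local Notation fam a := (fun k : nat => (a, k) : idx).

Lemma famK (a : 'I_N) : cancel (fam a) snd. Proof. by []. Qed.

(** * The translation operator and its commutator with the Virasoro operators *)

Section Translation.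
Variable dT : 'I_N -> nat -> K.

Definition aTlog p : A :=
  \sum_(k \in [set k : nat | (1 <= k)%N]%classic) \sum_(a < N)
    dT a k *: D (a, k) p.

Lemma aTlog_evz p : evz (fun k => \sum_(a < N) dT a k *: D (a, k) p).
Proof.
have [B hB] := pder_level C snd p; exists B => k hk.
by apply: big1 => a _; rewrite hB // scaler0.
Qed.

Lemma aTlog_linear : linear aTlog.
Proof.
apply: fsum_linear => [k|]; last exact: aTlog_evz.
by apply: linear_sum_fun => a; apply: linear_scale; apply: linearP.
Qed.

HB.instance Definition _ := GRing.isLinear.Build K A A *:%R aTlog aTlog_linear.

Lemma aTlog_pder i p : aTlog (D i p) = D i (aTlog p).
Proof.
rewrite (raddf_fsum (D i)); last exact: aTlog_evz.
apply: eq_fsbigr => k _; rewrite /= linear_sum; apply: eq_bigr => a _.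
by rewrite linearZ /= pderC.
Qed.

Lemma aTlog_afderiv (v : nat -> idx) k p :
  aTlog (afderiv C v k p) = afderiv C v k (aTlog p).
Proof. by case: k => k /=; rewrite ?linear0 // aTlog_pder. Qed.

Variables (al : nat) (a : 'I_N) (m : int).

Let c (k : nat) : K := (oddfact (m + k%:Z + 1))%:R / (oddfact k)%:R * dT a k.

(* Twice the extra term of [Lambda], without its factor [1 / hbar]. *)
Definition adilaton p : A :=
  \sum_(k \in [set k : nat | (1 + al <= k)%N]%classic)
     c k *: afderiv C (fam a) (m + k%:Z) p.

Lemma adilaton_evz p :
  evz (fun k : nat => c k *: afderiv C (fam a) (m + k%:Z) p).
Proof.
have [B hB] := afderiv_level C (@famK a) p; exists (B + `|m|)%N => k hk.
by rewrite hB ?scaler0 //; lia.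
Qed.

Lemma adilaton_linear : linear adilaton.
Proof.
apply: fsum_linear => [k|]; last exact: adilaton_evz.
by apply: linear_scale; apply: linearP.
Qed.

HB.instance Definition _ :=
  GRing.isLinear.Build K A A *:%R adilaton adilaton_linear.

Hypothesis dT_al : al = 1%N -> dT a 1%N = 0.
Hypothesis al2 : (al < 2)%N.
Hypothesis hm : - al%:Z <= m.

(* The terms with [1 <= k < 1 + al] vanish since [dT a 1 = 0] for [al = 1]. *)
Lemma adilaton_ge1 p : adilaton p =
  \sum_(k \in [set k : nat | (1 <= k)%N]%classic)
     c k *: afderiv C (fam a) (m + k%:Z) p.
Proof.
apply: fsbig_widen => k /=.
  by move=> h; apply: leq_trans h; rewrite leq_addr.
move=> [k1 /negP]; rewrite -ltnNge => k2.
have al1 : al = 1%N by lia.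
have -> : k = 1%N by lia.
by rewrite /c dT_al // mulr0 scale0r.
Qed.

(** The derivatives in the other families commute with the operator; those of family [a] contribute
    the commutators of [avirasoro_commute_pder], which add up to [adilaton]. *)
Lemma aTlog_avirasoro p :
  aTlog (avirasoro C (fam a) m p) =
  avirasoro C (fam a) m (aTlog p) + adilaton p.
Proof.
rewrite adilaton_ge1.
(* Bundled as a linear map, the operator can be moved inside the sum over [k]. *)
have [V VE] : exists V : {linear A -> A},
    forall q, avirasoro C (fam a) m q = V q.
  by exists (HB.pack_for {linear A -> A} (avirasoro C (fam a) m)
    (GRing.isLinear.Build K A A *:%R _ (avirasoro_linear C (@famK a) m))).
rewrite !VE (raddf_fsum V); last exact: aTlog_evz.
rewrite -fsumD; [|exact: (evz_raddf V (aTlog_evz p))|exact: adilaton_evz].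
apply: eq_fsbigr => k; rewrite in_setE /= => k1; rewrite linear_sum /=.
rewrite [LHS](bigD1 a) //= [X in _ = X + _](bigD1 a) //= [RHS]addrAC.
congr (_ + _).
  rewrite linearZ /= -!VE.
  rewrite (avirasoro_commute_pder C (@famK a)) //; last by lia.
  by rewrite scalerDr scalerA /c [dT a k * _]mulrC.
apply: eq_bigr => b ba; rewrite linearZ /= -!VE; congr (_ *: _).
apply: (avirasoro_intertwine (C := C) (E := C) (@famK a)) => j q.
  by rewrite pder_var xpair_eqE (negbTE ba) add0r.
exact: pderC.
Qed.

Lemma adilaton_aTlog p : aTlog (adilaton p) = adilaton (aTlog p).
Proof.
rewrite (raddf_fsum aTlog); last exact: adilaton_evz.
by apply: eq_fsbigr => k _; rewrite /= linearZ /= aTlog_afderiv.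
Qed.

End Translation.

Lemma aTlog_deg dT w d e p :
  (forall a k, (1 <= k)%N -> dT a k != 0 -> e <= (w (a, k))%:Z) ->
  deg w d p -> deg w (d - e) (aTlog dT p).
Proof.
move=> hw hp; apply: pdeg_fsum => k /= k1; apply: pdeg_sum => a _.
case: (eqVneq (dT a k) 0) => [->|h]; first by rewrite scale0r; apply: pdeg0.
apply/pdegZ/(pdeg_trans _ (pdeg_der _ hp)).
by rewrite lerB // hw.
Qed.

(** * Local nilpotency of the exponent of the rotation operator *)

Section Rotation.
Variable r : nat -> 'M[K]_N.

Definition aRlog p : A :=
  \sum_(k \in [set k : nat | (1 <= k)%N]%classic) \sum_(a < N) \sum_(b < N)
    (\sum_(j \in [set: nat])
        r k b a *: (X (a, j) * D (b, (k + j)%N) p)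
     + 2^-1 *: \sum_(j < k)
        ((-1) ^+ j.+1 * r k b a) *:
          D (a, j : nat) (D (b, (k - j - 1)%N) p)).

Lemma aRlog_linear : linear aRlog.
Proof.
apply: fsum_linear => [k|p].
  apply: linear_sum_fun => a; apply: linear_sum_fun => b; apply: linear_add.
    apply: fsum_linear => [j c p q|p].
      by rewrite linearP mulrDr -scalerAr scalerDr !scalerA mulrC.
    have [B hB] := pder_level C snd p; exists B => j hj.
    by rewrite hB ?mulr0 ?scaler0 //= (leq_trans hj) ?leq_addl.
  apply: linear_scale; apply: linear_sum_fun => j; apply: linear_scale.
  by move=> c p q; rewrite !linearP.
(* In a second-order term the two indices add up to [k - 1 >= 2 B], so one of them is at least
   [B]. *)
have [B hB] := pder_level C snd p; exists (B + B).+1 => k hk.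
apply: big1 => a _; apply: big1 => b _; rewrite fsbig1 ?add0r => [|j _].
  rewrite big1 ?scaler0 // => j _; case: (leqP B j) => hj.
    by rewrite pderC [D (a, _) p]hB // linear0 scaler0.
  by rewrite [D (b, _) p]hB ?linear0 ?scaler0 //=; lia.
by rewrite hB ?mulr0 ?scaler0 //=; lia.
Qed.

HB.instance Definition _ := GRing.isLinear.Build K A A *:%R aRlog aRlog_linear.

(** First-order terms lower the weight by [k], second-order terms by [k + 1]. The weight of [T^a_j]
    is [j + 1] rather than [j] so that the second derivatives in the variables [T_0], which occur
    for [k = 1], lower it too. *)
Lemma aRlog_deg d p :
  deg (fun i => i.2.+1) d p -> deg (fun i => i.2.+1) (d - 1) (aRlog p).
Proof.
move=> hp; apply: pdeg_fsum => k /= k1.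
apply: pdeg_sum => a _; apply: pdeg_sum => b _; apply: pdegD.
  apply: pdeg_fsum => j _; apply: pdegZ.
  have := pdegM (pdeg_var C _ (a, j)) (pdeg_der (b, (k + j)%N) hp).
  apply: pdeg_trans.
  by rewrite /=; lia.
apply/pdegZ/pdeg_sum => j _; apply: pdegZ.
apply: (pdeg_trans _ (pdeg_der (a, j : nat) (pdeg_der (b, (k - j - 1)%N) hp))).
by rewrite /=; lia.
Qed.

Lemma aRlog_evz p : evz (fun l => iter l aRlog p).
Proof.
have [d hd] := pdeg_exists C (fun i => i.2.+1) p.
exists (`|d|.+1)%N => l hl.
apply: pdeg_neg (pdeg_iter l aRlog_deg hd); lia.
Qed.

End Rotation.
End Operators.

(** * Virasoro constraints *)

Section Constraints.
Variables (K : numFieldType) (N : nat).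
Local Notation idx := ('I_N * nat)%type.
Variables (A : comAlgType K) (C : polycalc idx A).
Local Notation D := (pder C).
Local Notation deg := (pdeg C).
Implicit Types (p q : A).

Local Notation fam a := (fun k : nat => (a, k) : idx).

(* [to_hseries] over an abstract algebra. *)
Definition hser (V : zmodType) (f : nat -> V) (n : int) : V :=
  if n is Posz k then f k else 0.

Section OneConstraint.
Variables (al : nat) (s : K) (a : 'I_N) (m : int).

(* The operator annihilating the factor of index [a] is
   [lhs_op - rhs_op / hbar]. *)
Definition lhs_op p : A :=
  2^-1 *: avirasoro C (fam a) m p + ((m == 0)%:R / 16) *: p.

Definition rhs_op p : A :=
  ((oddfact (m + al%:Z + 1))%:R / (2 * s)) *:
    afderiv C (fam a) (m + al%:Z) p.

Lemma lhs_op_linear : linear lhs_op.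
Proof.
apply: linear_add; apply: linear_scale; last exact: linear_id.
exact: (avirasoro_linear C (lev := snd)).
Qed.

HB.instance Definition _ :=
  GRing.isLinear.Build K A A *:%R lhs_op lhs_op_linear.

Lemma rhs_op_linear : linear rhs_op.
Proof. by apply: linear_scale; apply: linearP. Qed.

HB.instance Definition _ :=
  GRing.isLinear.Build K A A *:%R rhs_op rhs_op_linear.

(** [lhs_op] is half a Virasoro operator plus a scalar, so its commutator with [aTlog] is half of
    [adilaton]; this is the [Y] of [exp_intertwine]. *)
Lemma translated_constraint (dT : 'I_N -> nat -> K) (F : int -> A) :
  (al = 1%N -> dT a 1%N = 0) -> (al < 2)%N -> - al%:Z <= m ->
  (forall n, lhs_op (F n) = rhs_op (F (n + 1))) ->
  (forall n, evz (fun l => iter l (aTlog C dT) (F (n + l%:Z)))) ->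
  let G n := \sum_(l \in [set: nat])
    l`!%:R^-1 *: iter l (aTlog C dT) (F (n + l%:Z)) in
  forall n, lhs_op (G n) + 2^-1 *: adilaton C dT al a m (G (n + 1)) =
    rhs_op (G (n + 1)).
Proof.
move=> dT1 al2 hm hF Ffin.
pose Y := HB.pack_for {linear A -> A}
  (fun p => 2^-1 *: adilaton C dT al a m p)
  (GRing.isLinear.Build K A A *:%R _
    (linear_scale 2^-1 (adilaton_linear C dT al a m))).
apply: (@exp_intertwine _ _ (aTlog C dT) lhs_op Y rhs_op) => // q /=.
- rewrite /lhs_op [LHS]linearD !linearZ /=.
  rewrite (aTlog_avirasoro C dT1 al2 hm) scalerDr.
  by rewrite -!addrA; congr (_ + _); rewrite addrC.
- by rewrite linearZ /= adilaton_aTlog.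
- by rewrite /rhs_op linearZ /= aTlog_afderiv.
Qed.

(** The constraint on a power series in hbar, order by order; the condition on [f 0] is the one at
    order [-1]. *)
Definition satisfies (f : nat -> A) : Prop :=
  rhs_op (f 0%N) = 0 /\ forall n, lhs_op (f n) = rhs_op (f n.+1).

Lemma satisfies_hser (f : nat -> A) n :
  satisfies f -> lhs_op (hser f n) = rhs_op (hser f (n + 1)).
Proof.
move=> [f0 fS]; case: n => [n|[|n]].
- have -> : n%:Z + 1 = n.+1%:Z by lia.
  exact: fS.
- exact: etrans (linear0 _) (esym f0).
- have -> : Negz n.+1 + 1 = Negz n by lia.
  by rewrite /= !linear0.
Qed.

Lemma lhs_op_mulr p q : (forall k, D (a, k) q = 0) ->
  lhs_op (q * p) = q * lhs_op p.
Proof.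
move=> hq; have qlin : linear ( *%R q).
  by move=> c x y; rewrite mulrDr scalerAr.
pose phi := HB.pack_for {linear A -> A} ( *%R q)
  (GRing.isLinear.Build K A A *:%R _ qlin).
have vir : q * avirasoro C (fam a) m p = avirasoro C (fam a) m (q * p).
  apply: (@avirasoro_intertwine _ _ _ _ _ C C (fam a) snd _ (fam a) phi) => //.
    by move=> k x; rewrite /= mulrCA.
  by move=> k x; rewrite /= pder_mul hq mul0r add0r.
by rewrite /lhs_op -vir [RHS]mulrDr -!scalerAr.
Qed.

Lemma rhs_op_mulr p q : (forall k, D (a, k) q = 0) ->
  rhs_op (q * p) = q * rhs_op p.
Proof.
move=> hq; rewrite /rhs_op; case: (m + al%:Z) => k /=.
  by rewrite pder_mul hq mul0r add0r scalerAr.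
by rewrite !scaler0 mulr0.
Qed.

(** The coefficients of [g] are constants for the operators of family [a]. At order [n + 1] the
    right-hand side has one more term than the left-hand side; it contains [rhs_op (f 0)], which
    vanishes. *)
Lemma satisfies_pmul_l (f g : nat -> A) :
  satisfies f -> (forall k n, D (a, k) (g n) = 0) ->
  satisfies (fun n => \sum_(i < n.+1) f i * g (n - i)%N).
Proof.
move=> [f0 fS] hg; have com x n : rhs_op (x * g n) = rhs_op x * g n.
  by rewrite mulrC rhs_op_mulr // mulrC.
split=> [|n]; first by rewrite big_ord1 com f0 mul0r.
rewrite !linear_sum [RHS]big_ord_recl /= com f0 mul0r add0r.
apply: eq_bigr => i _; rewrite com -fS subSS.
by rewrite mulrC lhs_op_mulr // mulrC.
Qed.

Lemma satisfies_pmul_r (f g : nat -> A) :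
  satisfies g -> (forall k n, D (a, k) (f n) = 0) ->
  satisfies (fun n => \sum_(i < n.+1) f i * g (n - i)%N).
Proof.
move=> [g0 gS] hf; have com n x : rhs_op (f n * x) = f n * rhs_op x.
  by rewrite rhs_op_mulr.
split=> [|n]; first by rewrite big_ord1 com subnn g0 mulr0.
rewrite !linear_sum [RHS]big_ord_recr /= com subnn g0 mulr0 addr0.
apply: eq_bigr => i _; rewrite com subSn -?gS ?lhs_op_mulr //.
by rewrite -ltnS.
Qed.

End OneConstraint.

Definition apmul (f g : nat -> A) : nat -> A :=
  fun n => \sum_(i < n.+1) f i * g (n - i)%N.

Definition apone : nat -> A := fun n => (n == 0%N)%:R.

Lemma apmul_free i (f g : nat -> A) :
  (forall n, D i (f n) = 0) -> (forall n, D i (g n) = 0) ->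
  forall n, D i (apmul f g n) = 0.
Proof.
move=> hf hg n; rewrite linear_sum big1 // => j _.
by rewrite /= pder_mul hf hg mul0r mulr0 addr0.
Qed.

Lemma apone_free i n : D i (apone n) = 0.
Proof. by rewrite /apone; case: eqP => _; rewrite ?linear0 ?pder1. Qed.

(** * Products over the families *)

Section Product.
Variable f : 'I_N -> nat -> A.
Hypothesis f_free : forall a b k n, b != a -> D (b, k) (f a n) = 0.

Lemma bigprod_free (S : seq 'I_N) b k n :
  b \notin S -> D (b, k) ((\big[apmul/apone]_(a <- S) f a) n) = 0.
Proof.
elim: S n => [|a S IHS] n; first by rewrite big_nil apone_free.
rewrite inE negb_or big_cons => /andP[ba bS].
by apply: apmul_free => j; [apply: f_free|apply: IHS].
Qed.

(** Induction on [S]: when [a] is the head, the tail is free of family [a] because [S] has no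
    repetition; otherwise the head is free of it. *)
Lemma bigprod_satisfies (S : seq 'I_N) al s a m :
  uniq S -> a \in S -> satisfies al s a m (f a) ->
  satisfies al s a m (\big[apmul/apone]_(b <- S) f b).
Proof.
move=> uS aS fa; elim: S uS aS => //= b S IHS /andP[bS uS].
rewrite inE big_cons; case: eqVneq => [<-{b}|ab] in bS * => /= aS.
  by apply: satisfies_pmul_l => // k n; apply: bigprod_free.
by apply: satisfies_pmul_r => [|k n]; [apply: IHS|apply: f_free].
Qed.

Lemma bigprod_deg w (S : seq 'I_N) (e : nat) n :
  (forall a n, deg w (e * n)%:Z (f a n)) ->
  deg w (e * n)%:Z ((\big[apmul/apone]_(b <- S) f b) n).
Proof.
move=> hf; elim: S n => [|a S IHS] n.
  rewrite big_nil /apone; case: eqP => [->|_]; last exact: pdeg0.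
  by rewrite muln0; apply: pdeg1.
rewrite big_cons; apply: pdeg_sum => i _.
have -> : (e * n)%:Z = (e * i)%:Z + (e * (n - i))%:Z.
  by rewrite -PoszD -mulnDr subnKC // -ltnS.
exact: pdegM.
Qed.

End Product.

(** The factor [g = 3 - 2 al] satisfies [g (2 al + 1) = 3] for both values of [al]. For [m = k - al]
    the constraint expresses the derivative of [f n.+1] along [T_k] by [lhs_op (f n)], of weight at
    most [3 n - 2 g m = 3 (n + 1) - g (2 k + 1)]. *)
Lemma satisfies_deg al s a (f : nat -> A) w n :
  (al < 2)%N -> s != 0 ->
  (forall m, - al%:Z <= m -> satisfies al s a m f) ->
  (forall b k n, b != a -> D (b, k) (f n) = 0) ->
  (forall k, w (a, k) = ((3 - 2 * al) * (2 * k + 1))%N) ->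
  deg w (3 * n)%:Z (f n).
Proof.
move=> al2 s0 hf ff hw.
have inv m p q : q = rhs_op al s a m p ->
    afderiv C (fam a) (m + al%:Z) p =
    ((oddfact (m + al%:Z + 1))%:R / (2 * s))^-1 *: q.
  move=> ->; rewrite scalerA mulVf ?scale1r //.
  by rewrite mulf_neq0 ?oddfact_neq0 // invr_eq0 mulf_neq0 // pnatr_eq0.
(* At order 0 the constraints make all derivatives vanish, so [f 0] is constant. *)
elim: n => [|n IHn]; apply: pdeg_of_der => // -[b k].
  case: (eqVneq b a) => [->{b}|ba]; last by rewrite ff //; apply: pdeg0.
  have hm : - al%:Z <= k%:Z - al%:Z by lia.
  have := inv _ _ _ (esym (hf _ hm).1).
  by rewrite subrK scaler0 /= => ->; apply: pdeg0.
case: (eqVneq b a) => [->{b}|ba]; last by rewrite ff //; apply: pdeg0.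
have hm : - al%:Z <= k%:Z - al%:Z by lia.
have := inv _ _ _ ((hf _ hm).2 n).
rewrite subrK /= => ->; apply/pdegZ/pdegD.
  apply/pdegZ/(pdeg_trans _ (avirasoro_deg (v := fam a) _ hw IHn)).
  by rewrite hw; case: al al2 {hf hw inv hm} => [|[|]] // _; lia.
case: eqP => [h|_]; last by rewrite mul0r scale0r; apply: pdeg0.
apply/pdegZ/(pdeg_trans _ IHn); rewrite hw.
by case: al al2 {hf hw inv hm} h => [|[|]] // _; lia.
Qed.

Lemma translation_evz (al : 'I_N -> nat) (dT : 'I_N -> nat -> K)
    (F : int -> A) :
  (forall a, (al a < 2)%N) -> (forall a, al a = 1%N -> dT a 1%N = 0) ->
  (forall n, deg (fun i => (3 - 2 * al i.1) * (2 * i.2 + 1))%N (3 * n) (F n)) ->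
  forall n, evz (fun l => iter l (aTlog C dT) (F (n + l%:Z))).
Proof.
(* Lowering [3 (n + l)] by 5 in each of [l] steps gives [3 n - 2 l], negative for
   [l >= 2 (|n| + 1)]. *)
move=> al2 dT1 hF n; exists (2 * `|n|.+1)%N => l hl.
have hT d p : deg (fun i => (3 - 2 * al i.1) * (2 * i.2 + 1))%N d p ->
    deg (fun i => (3 - 2 * al i.1) * (2 * i.2 + 1))%N (d - 5) (aTlog C dT p).
  apply: aTlog_deg => a k k1 dk /=.
  (* The shifted variables have weight at least 9 for [al = 0], where [k >= 1], and at least 5 for
     [al = 1], where [k >= 2]. *)
  have := al2 a; case E : (al a) => [|[|]] // _; first by lia.
  by case: k k1 dk => [|[|k]] //; rewrite ?dT1 ?eqxx //; lia.
apply: pdeg_neg (pdeg_iter l hT (hF _)); lia.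
Qed.

(** * Renaming the variables of a tau-function and rescaling hbar *)

Section Substitution.
Variables (B : comAlgType K) (CB : polycalc nat B) (a : 'I_N).
Variable psi : {linear B -> A}.
Hypothesis psi1 : psi 1 = 1.
Hypothesis psi_var : forall k (x : B),
  psi (pvar CB k * x) = pvar C (a, k) * psi x.

Lemma subst_der k (x : B) : psi (pder CB k x) = D (a, k) (psi x).
Proof.
elim/(pc_ind CB): x => [c x y IHx IHy||j x IHx].
- by rewrite !linearP /= IHx IHy.
- by rewrite psi1 !pder1 linear0.
- rewrite pder_var psi_var pder_var linearD linearMn /= psi_var IHx.
  by rewrite xpair_eqE eqxx.
Qed.

Lemma subst_free b k (x : B) : b != a -> D (b, k) (psi x) = 0.
Proof.
move=> ba; elim/(pc_ind CB): x => [c x y IHx IHy||j x IHx].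
- by rewrite !linearP /= IHx IHy scaler0 addr0.
- by rewrite psi1 pder1.
- by rewrite psi_var pder_var IHx mulr0 xpair_eqE (negbTE ba) addr0.
Qed.

(** The factor [s ^ n] replaces hbar by [s * hbar]. The two sides of the constraint differ by one
    order, whence the [1 / s] in [rhs_op]. *)
Lemma subst_satisfies al (tau : nat -> B) s m : s != 0 ->
  (forall n : int, 2^-1 *: avirasoro CB id m (hser tau n)
    - ((oddfact (m + al%:Z + 1))%:R / (2 * 1)) *:
        afderiv CB id (m + al%:Z) (hser tau (n + 1))
    + ((m == 0)%:R / 16) *: hser tau n = 0) ->
  satisfies al s a m (fun n => s ^+ n *: psi (tau n)).
Proof.
move=> s0 htau.
have vir x : psi (avirasoro CB id m x) = avirasoro C (fam a) m (psi x).
  apply: (@avirasoro_intertwine _ _ _ _ _ CB C id id) => // k y.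
  exact: subst_der.
have der k x : psi (afderiv CB id k x) = afderiv C (fam a) k (psi x).
  by apply: afderiv_intertwine => j y; exact: subst_der.
have c0 : (oddfact (m + al%:Z + 1))%:R / (2 * 1) != 0 :> K.
  by rewrite mulr1 mulf_neq0 ?oddfact_neq0 // invr_eq0 pnatr_eq0.
have V0 : avirasoro CB id m 0 = 0.
  exact: (@avirasoro0 _ _ _ CB id id).
split=> [|n].
  (* At order [-1] only the derivative of [tau 0] remains. *)
  have := htau (-1); rewrite addNr /= V0 !scaler0 add0r addr0 => /eqP.
  rewrite oppr_eq0 scaler_eq0 (negbTE c0) /= => /eqP h.
  by rewrite /rhs_op expr0 scale1r -der h linear0 scaler0.
have nS : n%:Z + 1 = n.+1%:Z by lia.
have move_rhs (x y z : A) : x - y + z = 0 -> x + z = y.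
  by rewrite addrAC => /subr0_eq.
have h := congr1 psi (htau n%:Z).
rewrite nS /= linear0 linearD linearB !linearZ /= vir der scalerN in h.
have key := move_rhs _ _ _ h.
rewrite [LHS]linearZ /= /lhs_op key /rhs_op.
rewrite [afderiv _ _ _ (s ^+ n.+1 *: _)]linearZ /= !scalerA.
by congr (_ *: _); rewrite exprS mulr1; field.
Qed.

End Substitution.

End Constraints.

(** * The ancestor potential *)

Section Instances.
Variables (K : numFieldType) (I : choiceType).

Definition tpoly_alg : comAlgType K := {malg K[{cmonom I}]}.

Definition tpoly_calc : polycalc I tpoly_alg :=
  @PolyCalc K I tpoly_alg tvar
    (fun i => @tderiv K I i : {linear tpoly_alg -> tpoly_alg})
    (@wle K I) (@tpoly_ind K I) (@tderiv1 K I) (@tderiv_tvarM K I)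
    (@wle0 K I) (@wle_lin K I) (@wle_trans K I) (@wle_neg K I) (@wle1 K I)
    (@wle_tvar K I) (@wleM K I) (@wle_tderiv K I) (@wle_of_tderiv K I).

End Instances.

Section HbarSeries.
Variables (K : numFieldType) (I : choiceType).
Implicit Types (F : hseries K I) (n : int).

Lemma iter_coefwise (Z : tpoly K I -> tpoly K I) l F n :
  iter l (coefwise Z) F n = iter l Z (F n).
Proof. by elim: l => //= l <-. Qed.

Lemma iter_hinv (Z : tpoly K I -> tpoly K I) l F n :
  iter l (fun F => hinv (coefwise Z F)) F n = iter l Z (F (n + l%:Z)).
Proof.
elim: l n => [|l IHl] n /=; first by rewrite addr0.
rewrite /hinv /coefwise IHl; congr (Z (iter l Z (F _))); lia.
Qed.

Lemma iter_opp_coefwise (Z : {linear tpoly_alg K I -> tpoly_alg K I}) l F n :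
  iter l (opp_op (coefwise Z)) F n = (-1) ^+ l *: iter l Z (F n).
Proof.
elim: l n => [|l IHl] n /=; first by rewrite expr0 scale1r.
rewrite /opp_op /coefwise IHl exprS mulN1r scaleNr; congr (- _).
exact: linearZ.
Qed.

End HbarSeries.

Section Ancestor.
Variables (K : numFieldType) (N : nat).
Local Notation idx := ('I_N * nat)%type.
Local Notation A := (tpoly_alg K idx).
Local Notation C := (tpoly_calc K idx).

Lemma Rhat0 r n : @Rhat K N r (fun _ => 0) n = 0.
Proof.
apply: fsbig1 => l _; rewrite iter_coefwise.
have -> : iter l (Rlog r) 0 = 0 :> A by exact: (linear0 (iter l (aRlog C r))).
exact: (scaler0 A).
Qed.

Lemma Rhat_invK r (G : hseries K idx) : Rhat_inv r (Rhat r G) = G.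
Proof.
apply/funext => n; apply: etrans (exp_opp_exp (aRlog_evz C r (G n))).
apply: eq_fsbigr => l _.
(* Over [tpoly_calc] the operator [aRlog] is convertible to [Rlog], which carries the abstract
   results over to C[T]. *)
have expE : Rhat r G n =
    \sum_(k \in [set: nat]) k`!%:R^-1 *: iter k (aRlog C r) (G n) :> A.
  apply: eq_fsbigr => k _.
  have h := congr1 (fun x : A => k`!%:R^-1 *: x) (iter_coefwise (Rlog r) k G n).
  exact h.
apply: etrans (congr1 (fun x : A => l`!%:R^-1 *: x)
  (iter_opp_coefwise (aRlog C r) l (Rhat r G) n)) _.
have h := congr1 (fun x : A =>
  l`!%:R^-1 *: ((-1) ^+ l *: iter l (aRlog C r) x)) expE.
exact h.
Qed.

Variables (tau : 'I_2 -> pseries K nat).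
Hypothesis htau : forall al : 'I_2, is_tau al (tau al).
Variables (alpha : 'I_N -> 'I_2) (dT : 'I_N -> nat -> K) (sD : 'I_N -> K).
Hypothesis hdT : forall a : 'I_N, alpha a = 1%N :> nat -> dT a 1%N = 0.
Hypothesis sD0 : forall a, sD a != 0.

Let factor (a : 'I_N) (n : nat) : A :=
  sD a ^+ n *: rename (fun k : nat => (a, k) : idx) (tau (alpha a) n).

Lemma rename_linear_fun (a : 'I_N) :
  exists2 psi : {linear tpoly_alg K nat -> A},
    (forall p, psi p = rename (fun k : nat => (a, k) : idx) p) &
    psi 1 = 1 /\ (forall k p, psi (pvar (tpoly_calc K nat) k * p) =
      pvar C (a, k) * psi p).
Proof.
pose psi := HB.pack_for {linear tpoly_alg K nat -> A}
  (@rename K nat idx (fun k : nat => (a, k) : idx))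
  (GRing.isLinear.Build K (tpoly_alg K nat) A *:%R _
    (rename_linear (fun k : nat => (a, k) : idx))).
exists psi => //; split; first exact: rename1.
move=> k p; exact: (rename_tvarM (fun k : nat => (a, k) : idx) k p).
Qed.

Lemma factor_satisfies a m : - (alpha a : nat)%:Z <= m ->
  satisfies C (alpha a) (sD a) a m (factor a).
Proof.
move=> hm; have [psi psiE [psi1 psiX]] := rename_linear_fun a.
have -> : factor a = fun n => sD a ^+ n *: psi (tau (alpha a) n).
  by apply/funext => n; rewrite psiE.
apply: (subst_satisfies psi1 psiX (sD0 a)) => n.
exact: (htau (alpha a)).2.
Qed.

Lemma factor_free a b k n : b != a -> pder C (b, k) (factor a n) = 0.
Proof.
move=> ba; have [psi psiE [psi1 psiX]] := rename_linear_fun a.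
rewrite /factor -psiE; apply: etrans (linearZ _ _) _.
by rewrite (subst_free psi1 psiX) //; exact: (scaler0 A).
Qed.

Let F := Delta_tau alpha sD tau.

Lemma Delta_tau_constraint a m n : - (alpha a : nat)%:Z <= m ->
  lhs_op C a m (F n) = rhs_op C (alpha a) (sD a) a m (F (n + 1)).
Proof.
move=> hm; apply: satisfies_hser.
apply: bigprod_satisfies; [exact: factor_free|exact: index_enum_uniq| |].
  exact: mem_index_enum.
exact: factor_satisfies.
Qed.

Lemma Delta_tau_evz n : evz (fun l => iter l (aTlog C dT) (F (n + l%:Z))).
Proof.
apply: (translation_evz (al := fun a => alpha a)) => // {}n.
set w := (w in pdeg C w).
case: n => n; last exact: pdeg0.
have -> : 3 * n%:Z = (3 * n)%:Z by lia.
apply: (bigprod_deg (f := factor)) => a j.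
apply: (@satisfies_deg K N A C (alpha a) (sD a) a (factor a) w j)
  => [|//|m|b k ba|//]; first exact: ltn_ord.
  exact: factor_satisfies.
exact: factor_free.
Qed.

Lemma That_defined_Delta_tau : That_defined dT F.
Proof.
move=> n; have [B hB] := Delta_tau_evz n.
apply: (@sub_finite_set _ _ `I_B%classic); last exact: finite_II.
move=> l /= hl; rewrite ltnNge; apply/negP => /hB h.
by case/negP: hl; apply/eqP; rewrite iter_hinv.
Qed.

Lemma Lambda_That a m : - (alpha a : nat)%:Z <= m ->
  Lambda alpha sD dT a m (That dT F) = fun _ => 0.
Proof.
move=> hm; apply/funext => n.
pose G n : A := \sum_(l \in [set: nat])
    l`!%:R^-1 *: iter l (aTlog C dT) (F (n + l%:Z)).
have GE : That dT F = G.
  apply/funext => j; apply: eq_fsbigr => l _; 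
  have h := congr1 (fun x : A => l`!%:R^-1 *: x) (iter_hinv (Tlog dT) l F j).
  exact h.
rewrite GE.
have := translated_constraint (hdT (a := a)) (ltn_ord _) hm
  (fun n => Delta_tau_constraint n hm) Delta_tau_evz n.
rewrite -/G /lhs_op /rhs_op => key.
have move_lhs (V : zmodType) (x y z t : V) : x + z + t = y -> x - y + z + t = 0.
  by move=> <-; rewrite -addrA addrAC addrA subrr.
exact: (move_lhs A _ _ _ _ key).
Qed.

Lemma assoc_virasoro_ancestor r a m n : - (alpha a : nat)%:Z <= m ->
  assoc_virasoro alpha sD r dT a m (ancestor alpha sD r dT tau) n = 0.
Proof.
move=> hm; rewrite /assoc_virasoro /ancestor Rhat_invK Lambda_That //.
exact: Rhat0.
Qed.

End Ancestor.

(** The first conjunct ensures that [That] is applied inside its domain, so the constraints do not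
    hold merely through the default value 0 of an infinite sum. *)
Theorem theorem2 (R : realType)
    (tau : 'I_2 -> pseries R[i] nat)
    (htau : forall al : 'I_2, is_tau al (tau al))
    (N : nat) (hN : (1 <= N)%N)
    (alpha : 'I_N -> 'I_2)
    (r : nat -> 'M[R[i]]_N)
    (dT : 'I_N -> nat -> R[i])
    (hdT : forall a : 'I_N, alpha a = 1%N :> nat -> dT a 1%N = 0)
    (Delta sqrtDelta : 'I_N -> R[i])
    (hDelta : forall a : 'I_N, Delta a != 0)
    (hsqrt : forall a : 'I_N, sqrtDelta a ^+ 2 = Delta a) :
  That_defined dT (Delta_tau alpha sqrtDelta tau) /\
  forall (a : 'I_N) (m : int), - (nat_of_ord (alpha a))%:Z <= m ->
    forall n : int,
      assoc_virasoro alpha sqrtDelta r dT a m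
        (ancestor alpha sqrtDelta r dT tau) n = 0.
Proof.
have s0 a : sqrtDelta a != 0.
  by apply: contraNneq (hDelta a) => s0; rewrite -hsqrt s0 expr0n.
split; first exact: (That_defined_Delta_tau htau hdT s0).
by move=> a m hm n; exact: (assoc_virasoro_ancestor htau hdT s0 r n hm).
Qed.
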